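(* Let $\varphi:\mathbb{F}_\infty\to\mathbb{R}$ be a function such that $\varphi(g)$ depends only on $\|g\|_2$, with $\varphi(e)=1$. The following are equivalent: (1) $\varphi$ is positive definite on $\mathbb{F}_\infty$; (2) there is a Borel probability measure $\mu$ on $[-1,1]$ such that $\varphi(g)=\int_{-1}^1 s^{\|g\|_2^2}\,d\mu(s)$ for all $g\in\mathbb{F}_\infty$ (with $0^0=1$). Moreover, if (2) holds, then $\mu$ is uniquely determined by $\varphi$.
   Context: $\mathbb{F}_\infty$ is the free group on countably infinitely many free generators. Every $g\ne e$ has a unique reduced form $g = a_1^{k_1}\cdots a_n^{k_n}$ with $a_j$ free generators, $a_j\neq a_{j+1}$, $k_j\in\mathbb{Z}\setminus\{0\}$; $\|g\|_2 := (\sum_{j} k_j^2)^{1/2}$, $\|e\|_2=0$. A function $\varphi$ on a group is positive definite if $\sum_{j,k=1}^n c_j\overline{c_k}\varphi(x_j^{-1}x_k)\ge0$ for all $n$, $x_i$ in the group, $c_i\in\mathbb{C}$. *)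

(* Defs.v *)
From HB Require Import structures.
From mathcomp Require Import all_boot all_order all_algebra.
From mathcomp Require Import complex.
From mathcomp Require Import all_classical all_reals all_analysis.

Set Implicit Arguments.
Unset Strict Implicit.
Unset Printing Implicit Defensive.
Import Order.TTheory GRing.Theory Num.Theory.
Local Open Scope ring_scope.

(* The free group F_oo on the countably many free generators a_0, a_1, ...   *)
(* (indexed by nat).  An element is its unique reduced form                   *)
(*   a_{i_1}^{k_1} ... a_{i_n}^{k_n},  i_j <> i_{j+1},  k_j <> 0,            *)
(* stored as the sequence of syllables [:: (i_1, k_1); ...; (i_n, k_n)].      *)
Definition syl := (nat * int)%type.

Definition reducedw (w : seq syl) : bool :=
  all (fun p : syl => p.2 != 0) w && sorted (fun p q : syl => p.1 != q.1) w.

(* mulrev rx y = (rev rx) * y : concatenation with free cancellation at the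
   junction *)
Fixpoint mulrev (rx y : seq syl) : seq syl :=
  match rx, y with
  | (a, k) :: rx', (b, l) :: y' =>
      if a == b then
        (if k + l == 0 then mulrev rx' y' else catrev rx' ((a, k + l) :: y'))
      else catrev rx y
  | _, _ => catrev rx y
  end.

Definition hd_ok (s t : seq syl) : bool :=
  match s, t with p :: _, q :: _ => p.1 != q.1 | _, _ => true end.

Lemma reducedw_cons p s :
  reducedw (p :: s) = [&& p.2 != 0, reducedw s & hd_ok [:: p] s].
Proof.
rewrite /reducedw /=; case: s => [|q s] /=; first by rewrite andbT.
by rewrite -!andbA; do !bool_congr.
Qed.

Lemma reducedw_rev s : reducedw (rev s) = reducedw s.
Proof.
rewrite /reducedw all_rev rev_sorted; congr (_ && _).
by apply: eq_sorted => p q /=; rewrite eq_sym.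
Qed.

Lemma reducedw_catrev rx y :
  reducedw rx -> reducedw y -> hd_ok rx y -> reducedw (catrev rx y).
Proof.
elim: rx y => [|p rx IH] y //= Hrx Hy Hh.
move: Hrx; rewrite reducedw_cons => /and3P[Hp Hrx Hh'].
apply: IH => //; first by rewrite reducedw_cons Hp Hy.
by case: rx Hh' {Hrx} => //= q rx; rewrite eq_sym.
Qed.

Lemma reducedw_mulrev rx y :
  reducedw rx -> reducedw y -> reducedw (mulrev rx y).
Proof.
elim: rx y => [|[a k] rx IH] y Hrx Hy; first by [].
case: y Hy => [|[b l] y] Hy; first by apply: reducedw_catrev.
move: (Hrx) (Hy); rewrite !reducedw_cons => /and3P[Hk Hrx' Hh1] /and3P[Hl Hy' Hh2].
rewrite /=; case: eqP => [eab|/eqP nab].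
  subst b; case: eqP => [_|/eqP Hkl]; first exact: IH.
  apply: reducedw_catrev => //; first by rewrite reducedw_cons Hkl Hy'.
  by case: rx Hh1 {Hrx' IH Hrx} => //= q rx; rewrite eq_sym.
exact: (reducedw_catrev Hrx Hy nab).
Qed.

Lemma reducedw_inv s : reducedw s -> reducedw (rev (map (fun p : syl => (p.1, - p.2)) s)).
Proof.
rewrite reducedw_rev /reducedw all_map => /andP[H1 H2]; apply/andP; split.
  by apply: sub_all H1 => p /=; rewrite oppr_eq0.
by elim: s H2 {H1} => //= p [|q s] IH //= /andP[-> H]; apply: IH.
Qed.

Definition FG : Type := {w : seq syl | reducedw w}.

Definition fg1 : FG := exist _ [::] erefl.

Definition fgmul (x y : FG) : FG :=
  exist _ (mulrev (rev (proj1_sig x)) (proj1_sig y))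
    (reducedw_mulrev (etrans (reducedw_rev _) (proj2_sig x)) (proj2_sig y)).

Definition fginv (x : FG) : FG :=
  exist _ (rev (map (fun p : syl => (p.1, - p.2)) (proj1_sig x)))
    (reducedw_inv (proj2_sig x)).

Definition fgnorm2sq (g : FG) : nat :=
  sumn (map (fun p : syl => (`|p.2| ^ 2)%N) (proj1_sig g)).

Definition fgnorm2 (R : realType) (g : FG) : R := Num.sqrt (fgnorm2sq g)%:R.

Definition posdef (R : realType) (phi : FG -> R[i]) : Prop :=
  forall (n : nat) (x : 'I_n -> FG) (c : 'I_n -> R[i]),
    0 <= \sum_(j < n) \sum_(k < n) c j * (c k)^* * phi (fgmul (fginv (x j)) (x k)).

(* Main.v *)
Require Import Defs.
From HB Require Import structures.
From mathcomp Require Import all_boot all_order all_algebra.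
From mathcomp Require Import complex ring lra.
From mathcomp Require Import all_classical all_reals all_analysis measurable_realfun.
Set Implicit Arguments.
Unset Strict Implicit.
Unset Printing Implicit Defensive.
Import Order.TTheory GRing.Theory Num.Theory.
Import numFieldNormedType.Exports.
Local Open Scope classical_set_scope.
Local Open Scope ring_scope.

(** Since [phi] only depends on [n = |g|_2^2], it is a sequence [f n].

  From (2) to (1), it suffices that [g |-> s ^ |g|_2^2] is positive definite for
  [s] in [[-1, 1]].  This kernel is multiplicative along the tree of syllables, so
  subtracting the rank-one kernel [s ^ |x|_2^2 * s ^ |y|_2^2] leaves a sum, over the
  common prefixes of [x] and [y], of copies of the kernel
  [s ^ (k - l)^2 - s ^ k^2 * s ^ l^2] on the integers, which is positive by expanding
  [exp (c k l)] in power series.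

  From (1) to (2), evaluating positive definiteness on many words with distinct
  first letters shows that the Hankel matrices [f (i + j)] are positive, and [f] is
  bounded by [1]; hence the functional [X^n |-> f n] is nonnegative on the Bernstein
  polynomials of [[-1, 1]].  Its values there are the weights of discrete
  probabilities whose moments converge to [f]; a limit of their distribution
  functions along an ultrafilter, made right-continuous, is the distribution function
  of [mu].

  Uniqueness holds because the polynomials [(1 - t^n)^(n 2^n)] converge boundedly on
  [[0, 1]] to the indicator of [t < 1/2]. *)

(** * Positive semidefinite kernels *)

Definition psdk (R : realType) (T : Type) (K : T -> T -> R) : Prop :=
  forall (n : nat) (c : 'I_n -> R) (x : 'I_n -> T),
    0 <= \sum_(i < n) \sum_(j < n) c i * c j * K (x i) (x j).

Section psd_kernels.
Context {R : realType}.

Lemma eq_psdk (T : Type) (K L : T -> T -> R) : psdk K -> K =2 L -> psdk L.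
Proof.
move=> psdK KL n c x; have := psdK n c x; congr (0 <= _).
by apply: eq_bigr => i _; apply: eq_bigr => j _; rewrite KL.
Qed.

Lemma psdk0 (T : Type) : psdk (fun _ _ : T => 0 : R).
Proof.
by move=> n c x; rewrite big1// => i _; rewrite big1// => j _; rewrite mulr0.
Qed.

Lemma psdkD (T : Type) (K L : T -> T -> R) :
  psdk K -> psdk L -> psdk (fun x y => K x y + L x y).
Proof.
move=> psdK psdL n c x.
have := addr_ge0 (psdK n c x) (psdL n c x); congr (0 <= _).
rewrite -big_split; apply: eq_bigr => i _.
by rewrite -big_split; apply: eq_bigr => j _; rewrite mulrDr.
Qed.

Lemma psdk_sum (T I : Type) (r : seq I) (K : I -> T -> T -> R) :
  (forall i, psdk (K i)) -> psdk (fun x y => \sum_(i <- r) K i x y).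
Proof.
move=> psdK; elim: r => [|i r IH].
  by apply: (eq_psdk (@psdk0 T)) => x y; rewrite big_nil.
by apply: (eq_psdk (psdkD (psdK i) IH)) => x y; rewrite big_cons.
Qed.

Lemma psdk_comp (T U : Type) (g : T -> U) (K : U -> U -> R) :
  psdk K -> psdk (fun x y => K (g x) (g y)).
Proof. by move=> psdK n c x; exact: (psdK n c (g \o x)). Qed.

Lemma psdk_scale (T : Type) (f : T -> R) (K : T -> T -> R) :
  psdk K -> psdk (fun x y => f x * f y * K x y).
Proof.
move=> psdK n c x; have := psdK n (fun i => c i * f (x i)) x; congr (0 <= _).
by apply: eq_bigr => i _; apply: eq_bigr => j _ /=; ring.
Qed.

Lemma psdk1 (T : Type) : psdk (fun _ _ : T => 1 : R).
Proof.
move=> n c x; suff -> : \sum_(i < n) \sum_(j < n) c i * c j * 1 =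
    (\sum_(i < n) c i) ^+ 2 by exact: sqr_ge0.
rewrite expr2 mulr_suml; apply: eq_bigr => i _; rewrite mulr_sumr.
by apply: eq_bigr => j _; rewrite mulr1.
Qed.

Lemma psdk_rank1 (T : Type) (f : T -> R) : psdk (fun x y => f x * f y).
Proof. by apply: (eq_psdk (psdk_scale f (@psdk1 T))) => x y; rewrite mulr1. Qed.

(** Over finitely many sample points, the indicator of [e x = e y] is the sum over the values [v] of
    the indicator of [e x = v] times that of [e y = v], so the kernel is a sum of rescalings of
    [K]. *)
Lemma psdk_block (T : Type) (A : eqType) (e : T -> A) (K : T -> T -> R) :
  psdk K -> psdk (fun x y => (e x == e y)%:R * K x y).
Proof.
move=> psdK n c x.
pose r := undup (codom (e \o x)).
pose L v x y : R := (e x == v)%:R * (e y == v)%:R * K x y.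
have psdL : psdk (fun x y => \sum_(v <- r) L v x y).
  by apply: psdk_sum => v; apply: (psdk_scale (fun x => (e x == v)%:R)).
have := psdL n c x; congr (0 <= _).
apply: eq_bigr => i _; apply: eq_bigr => j _; congr (_ * _).
have ir : e (x i) \in r by rewrite mem_undup (codom_f (e \o x)).
rewrite (bigD1_seq (e (x i)))//= ?undup_uniq// /L eqxx mul1r eq_sym big1 ?addr0//.
by move=> v; rewrite eq_sym => /negbTE ->; rewrite !mul0r.
Qed.

Lemma psdk_lim (T : Type) (K : nat -> T -> T -> R) (L : T -> T -> R) :
  (forall n, psdk (K n)) ->
  (forall x y, K n x y @[n --> \oo] --> L x y) -> psdk L.
Proof.
move=> psdK KL n c x.
have cv : \sum_(i < n) \sum_(j < n) c i * c j * K m (x i) (x j) @[m --> \oo] -->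
    \sum_(i < n) \sum_(j < n) c i * c j * L (x i) (x j).
  apply: cvg_big => [|p _]; first exact: add_continuous.
  apply: cvg_big => [|q _]; first exact: add_continuous.
  by apply: cvgMr; exact: KL.
rewrite -(cvg_lim _ cv)//; apply: limr_ge; first by apply/cvg_ex; eexists; exact: cv.
by apply: nearW => m; exact: psdK.
Qed.

End psd_kernels.

(** * Gaussian kernels on the integers *)

Section gaussian_kernel.
Context {R : realType}.

(** Subtracting [1] removes only the zeroth Taylor term; every other term is a rank-one kernel with
    a nonnegative coefficient. *)
Lemma psdk_expR_mul_sub1 (c : R) : 0 <= c ->
  psdk (fun x y : R => expR (c * x * y) - 1).
Proof.
move=> c0.
apply: (@psdk_lim _ _ (fun n x y => \sum_(0 <= i < n) exp_coeff (c * x * y) i.+1)).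
  move=> n; apply: psdk_sum => i.
  have psdi := psdk_rank1 (fun x : R => Num.sqrt (c ^+ i.+1 / i.+1`!%:R) * x ^+ i.+1).
  apply: (eq_psdk psdi) => x y; rewrite /exp_coeff /=.
  rewrite mulrACA -expr2 sqr_sqrtr; last by rewrite divr_ge0// exprn_ge0.
  by rewrite -mulrA exprMn exprMn -mulrA; ring.
move=> x y.
have cv : series (exp_coeff (c * x * y)) n.+1 @[n --> \oo] --> expR (c * x * y).
  by rewrite cvg_shiftS; exact: is_cvg_series_exp_coeff.
have : series (exp_coeff (c * x * y)) n.+1 - 1 @[n --> \oo] --> expR (c * x * y) - 1.
  by apply: cvgB cv _; exact: cvg_cst.
apply: cvg_trans; apply: near_eq_cvg.
near=> n; rewrite /series /= big_nat_recl//= /exp_coeff /= expr0 fact0 divr1.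
by rewrite addrC addKr.
Unshelve. all: by end_near. Qed.

(** For [s = exp (- c)], [s ^ (k - l)^2] equals [s ^ k^2 * s ^ l^2 * exp (2 c k l)], so the kernel
    is a rescaling of [exp (2 c k l) - 1]. *)
Lemma psdk_sqr_pow (s : R) : `|s| <= 1 ->
  psdk (fun k l : int =>
    s ^+ (`|(- k + l)%R| ^ 2)%N - s ^+ (`|k| ^ 2)%N * s ^+ (`|l| ^ 2)%N).
Proof.
move=> s1.
(* As [k^2] and [k] have the same parity, [(-1) ^ (k - l)^2] is a sign in [k] times a sign in [l]:
   replacing [s] by [- s] is a rescaling. *)
wlog s0 : s s1 / 0 <= s.
  move=> H; have [/H|s0] := leP 0 s; first exact.
  have := H (- s); rewrite normrN oppr_ge0 => /(_ s1 (ltW s0)) psds.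
  apply: (eq_psdk (psdk_scale (fun k : int => (-1) ^+ (`|k| ^ 2)%N) psds)) => k l.
  rewrite ![(- s) ^+ _]exprNn.
  have -> : (-1) ^+ (`|(- k + l)%R| ^ 2) = (-1) ^+ (`|k| ^ 2)%N * (-1) ^+ (`|l| ^ 2)%N :> R.
    have sgn2 (m : int) : (-1) ^+ (`|m| ^ 2)%N = (-1) ^ m :> R.
      by rewrite expN1r -signr_odd oddX /= signr_odd.
    rewrite !sgn2 expfzDr ?oppr_eq0 ?oner_eq0//; congr (_ * _).
    by rewrite !expN1r abszN.
  have sgnK n : (-1) ^+ n * (-1) ^+ n = 1 :> R by rewrite -expr2 sqrr_sign.
  move: (sgnK (`|k| ^ 2)%N) (sgnK (`|l| ^ 2)%N).
  move: ((-1) ^+ _) ((-1) ^+ _) => a b a2 b2.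
  transitivity ((a * a) * (b * b) * (s ^+ (`|(- k + l)%R| ^ 2)%N -
    s ^+ (`|k| ^ 2)%N * s ^+ (`|l| ^ 2)%N)); last by rewrite a2 b2 !mul1r.
  by ring.
have [s00|s_neq0] := eqVneq s 0.
  (* At [s = 0] the kernel is the indicator of [k = l <> 0], because [0 ^ 0 = 1]. *)
  have psdb := psdk_block id (psdk_rank1 (fun k : int => (k != 0)%:R : R)).
  apply: (eq_psdk psdb) => k l; rewrite s00 !expr0n /= !expn_eq0 !absz_eq0 !andbT.
  rewrite [- k + l]addrC subr_eq0 eq_sym.
  have [->|kl] := eqVneq k l.
    by case: (l == 0); rewrite !(mulr0, mulr1, mul0r, subrr, subr0).
  have [k0|k0] := eqVneq k 0; last by rewrite !mul0r subrr.
  by move: kl; rewrite k0 eq_sym => /negbTE ->; rewrite mul0r mulr0 subrr.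
have s_gt0 : 0 < s by rewrite lt_neqAle eq_sym s_neq0.
pose c := - ln s.
have c0 : 0 <= 2 * c by rewrite mulr_ge0// oppr_ge0 ln_le0// (le_trans (ler_norm s)).
have E (k : int) : s ^+ (`|k| ^ 2)%N = expR (- c * k%:~R ^+ 2).
  rewrite -{1}(lnK s_gt0) -expRM_natl /c opprK mulrC natrX natr_absz.
  by rewrite intr_norm real_normK ?num_real.
have psdc := psdk_comp (fun k : int => k%:~R : R) (psdk_expR_mul_sub1 c0).
apply: (eq_psdk (psdk_scale (fun k => s ^+ (`|k| ^ 2)%N) psdc)) => k l.
rewrite !E mulrBr mulr1 -!expRD; congr (expR _ - _).
by rewrite intrD intrN; ring.
Qed.

End gaussian_kernel.

(** * The kernel of the free group *)

Section free_group_kernel.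

Definition wnsq (w : seq syl) : nat := sumn [seq (`|p.2| ^ 2)%N | p : syl <- w].

(** The order of the syllables is kept: [mulrev] expects its first factor reversed, so
    [mulrev (winv x) y] is the word of [x^-1 y]. *)
Definition winv (w : seq syl) : seq syl := [seq (p.1, - p.2) | p : syl <- w].

Lemma wnsq_catrev (v w : seq syl) : wnsq (catrev v w) = (wnsq v + wnsq w)%N.
Proof.
elim: v w => //= p v IH w; rewrite IH /wnsq /=.
by rewrite addnCA addnA.
Qed.

Lemma wnsq_winv (w : seq syl) : wnsq (winv w) = wnsq w.
Proof. by elim: w => //= p w; rewrite /wnsq /= => ->; rewrite abszN. Qed.

Lemma wnsq_mulrev_hd (x y : seq syl) :
  hd_ok x y -> wnsq (mulrev (winv x) y) = (wnsq x + wnsq y)%N.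
Proof.
move=> xy; suff -> : mulrev (winv x) y = catrev (winv x) y.
  by rewrite wnsq_catrev wnsq_winv.
by case: x y xy => [|[a k] x] [|[b l] y] //= /negbTE ->.
Qed.

Lemma fgnorm2sq_invmul (x y : FG) :
  fgnorm2sq (fgmul (fginv x) y) = wnsq (mulrev (winv (sval x)) (sval y)).
Proof. by rewrite /fgnorm2sq /= revK. Qed.

Context {R : realType}.

(* The part of [s ^ |x^-1 y|_2^2] left after subtracting the rank-one kernel; the fuel
   [n] only has to bound the number of syllables of [x]. *)
Fixpoint tree_cov (s : R) (n : nat) (x y : seq syl) : R :=
  match n, x, y with
  | m.+1, (a, k) :: x', (b, l) :: y' =>
      (a == b)%:R * (s ^+ wnsq x' * s ^+ wnsq y' *
        (s ^+ (`|(- k + l)%R| ^ 2)%N - s ^+ (`|k| ^ 2)%N * s ^+ (`|l| ^ 2)%N)) +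
      ((a, k) == (b, l))%:R * tree_cov s m x' y'
  | _, _, _ => 0
  end.

(** Each level adds a block kernel over the first generator and a block kernel over the whole first
    syllable. *)
Lemma psdk_tree_cov (s : R) (n : nat) : `|s| <= 1 -> psdk (tree_cov s n).
Proof.
move=> s1; elim: n => [|n IH]; first exact: psdk0.
pose h := head (0%N, 0 : int) : seq syl -> syl.
have psd1 := psdk_comp (fun x => (h x).2) (psdk_sqr_pow s1).
have psd2 := psdk_scale (fun x => s ^+ wnsq (behead x)) psd1.
have psd3 := psdk_block (fun x => (h x).1) psd2.
have psd4 := psdk_block h (psdk_comp behead IH).
(* The indicator of nonempty words discards the default value of [h]. *)
have psd5 := psdk_scale (fun x : seq syl => (x != [::])%:R) (psdkD psd3 psd4).
apply: (eq_psdk psd5) => -[|[a k] x] [|[b l] y];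
  by rewrite /= ?(mul0r, mul1r, mulr0).
Qed.

(** If the first generators agree, equal exponents cancel and the induction continues on the tails;
    otherwise the two syllables merge into one of exponent [l - k] and cancellation stops. *)
Lemma exp_wnsq_mulrev (s : R) (n : nat) (x y : seq syl) : (size x <= n)%N ->
  s ^+ wnsq (mulrev (winv x) y) = s ^+ wnsq x * s ^+ wnsq y + tree_cov s n x y.
Proof.
elim: n x y => [|n IH] x y xn.
  by case: x xn => // _; rewrite wnsq_mulrev_hd// addr0 -exprD.
have [xy|] := boolP (hd_ok x y).
  rewrite wnsq_mulrev_hd// exprD -[LHS]addr0; congr (_ + _).
  case: x y xy {xn} => [|[a k] x] [|[b l] y] //= /negbTE ab.
  by rewrite xpair_eqE ab !mul0r addr0.
case: x y xn => [|[a k] x] [|[b l] y] //=; rewrite ltnS negbK => xn /eqP <-.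
rewrite xpair_eqE !eqxx /= !mul1r [- k + l]addrC subr_eq0 eq_sym.
rewrite /wnsq /= -!/(wnsq _) !exprD.
have [->|kl] := eqVneq k l.
  have -> : (`|(l - l)%R| ^ 2)%N = 0%N by rewrite subrr.
  by rewrite IH// expr0 mul1r; ring.
by rewrite mul0r wnsq_catrev wnsq_winv /wnsq /= -/(wnsq y) !exprD; ring.
Qed.

Lemma psdk_free_group (s : R) : `|s| <= 1 ->
  psdk (fun x y : FG => s ^+ fgnorm2sq (fgmul (fginv x) y)).
Proof.
move=> s1 n c x.
(* One amount of fuel has to serve all sample points. *)
pose m := \max_(i < n) size (sval (x i)).
have psdm := psdkD (psdk_rank1 (fun x : FG => s ^+ wnsq (sval x)))
  (psdk_comp sval (psdk_tree_cov m s1)).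
have := psdm n c x; congr (0 <= _).
apply: eq_bigr => i _; apply: eq_bigr => j _; congr (_ * _).
by rewrite fgnorm2sq_invmul (@exp_wnsq_mulrev _ m)// (leq_bigmax i).
Qed.

End free_group_kernel.

Lemma wnsq_mulrevC (x y : seq syl) :
  wnsq (mulrev (winv x) y) = wnsq (mulrev (winv y) x).
Proof.
elim: x y => [|[a k] x IH] y; first by rewrite !wnsq_mulrev_hd//; [exact: addnC | case: y].
case: y => [|[b l] y]; first by rewrite !wnsq_mulrev_hd// addnC.
rewrite /= eq_sym; have [<-|ab] := eqVneq; last first.
  by rewrite !wnsq_catrev !wnsq_winv /wnsq /= !abszN; ring.
have -> : (- l + k == 0) = (- k + l == 0).
  by rewrite -oppr_eq0 opprD opprK addrC.
case: ifP => _; first exact: IH.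
rewrite !wnsq_catrev !wnsq_winv /wnsq /=.
by rewrite (_ : - l + k = - (- k + l)) ?abszN; ring.
Qed.

(** * Complex and real positive definiteness *)

Section positive_definite.
Context {R : realType}.

(** For a symmetric real kernel, the imaginary part of the complex form cancels under exchange of
    indices, and the real part is the sum of the real forms at the real and imaginary parts of
    [c]. *)
Lemma posdef_psdk (phi : FG -> R) :
  (forall x y, phi (fgmul (fginv x) y) = phi (fgmul (fginv y) x)) ->
  posdef (fun g => real_complex R (phi g)) <->
  psdk (fun x y => phi (fgmul (fginv x) y)).
Proof.
move=> phiC; pose K x y := phi (fgmul (fginv x) y).
have ReS (n : nat) (F : 'I_n -> R[i]) :
    complex.Re (\sum_(i < n) F i) = \sum_(i < n) complex.Re (F i).
  exact: (raddf_sum (@complex.Re R : Rcomplex R -> R)).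
have ImS (n : nat) (F : 'I_n -> R[i]) :
    complex.Im (\sum_(i < n) F i) = \sum_(i < n) complex.Im (F i).
  exact: (raddf_sum (@complex.Im R : Rcomplex R -> R)).
split=> [pd n c x|psd n x c].
  have := pd n x (fun i => real_complex R (c i)).
  rewrite lecE => /andP[_]; rewrite ReS; congr (0 <= _).
  by apply: eq_bigr => i _; rewrite ReS; apply: eq_bigr => j _; rewrite /=; ring.
rewrite lecE; apply/andP; split.
  rewrite ImS.
  pose u i j := complex.Im (c i) * complex.Re (c j) * K (x i) (x j).
  suff -> : \sum_(i < n) complex.Im (\sum_(j < n)
      c i * (c j)^* * real_complex R (phi (fgmul (fginv (x i)) (x j)))) =
    \sum_(i < n) \sum_(j < n) u i j - \sum_(i < n) \sum_(j < n) u j i.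
    by rewrite exchange_big subrr.
  rewrite -sumrB; apply: eq_bigr => i _; rewrite ImS -sumrB; apply: eq_bigr => j _.
  rewrite /u /K (phiC (x j)).
  by case: (c i) (c j) => [a b] [a' b'] /=; ring.
have := addr_ge0 (psd n (fun i => complex.Re (c i)) x) (psd n (fun i => complex.Im (c i)) x).
congr (0 <= _); rewrite ReS -big_split; apply: eq_bigr => i _ /=.
rewrite ReS -big_split; apply: eq_bigr => j _ /=.
by case: (c i) (c j) => [a b] [a' b'] /=; ring.
Qed.

End positive_definite.

(** * Integrals and moments of finite measures *)

Section finite_measure_integral.
Context d (T : measurableType d) (R : realType) (mu : {finite_measure set T -> \bar R}).

Lemma integrable_bounded (A : set T) (f : T -> R) (M : R) :
  measurable A -> measurable_fun A f -> (forall x, A x -> `|f x| <= M) ->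
  mu.-integrable A (EFin \o f).
Proof.
move=> mA mf fM; apply: measurable_bounded_integrable => //.
  by rewrite -ge0_fin_numE// fin_num_measure.
by exists M; split; [exact: num_real | move=> N MN x Ax; exact: le_trans (fM x Ax) (ltW MN)].
Qed.

Lemma RintegralM_sum (A : set T) (I : Type) (r : seq I) (a : I -> R) (f : I -> T -> R) :
  measurable A -> (forall i, mu.-integrable A (EFin \o f i)) ->
  mu.-integrable A (EFin \o (fun x => \sum_(i <- r) a i * f i x)) /\
  Rintegral mu A (fun x => \sum_(i <- r) a i * f i x) =
  \sum_(i <- r) a i * Rintegral mu A (f i).
Proof.
move=> mA intf; elim: r => [|i r [IH1 IH2]].
  rewrite big_nil; under eq_fun do rewrite big_nil.
  split; last by rewrite Rintegral_cst// mul0r.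
  exact: finite_measure_integrable_cst.
have intai : mu.-integrable A (EFin \o (fun x => a i * f i x)).
  have := integrableZl mA (a i) (intf i).
  by apply: eq_integrable => // x _; rewrite /= EFinM.
rewrite big_cons; under eq_fun do rewrite big_cons.
split; last by rewrite RintegralD// RintegralZl// IH2.
have := integrableD mA intai IH1.
by apply: eq_integrable => // x _; rewrite /= EFinD.
Qed.

End finite_measure_integral.

Section moments.
Context {R : realType}.
Local Notation J := (`[(-1)%R, 1%R]%classic : set R).

Lemma norm_exp_itv (n : nat) (s : R) : J s -> `|s ^+ n| <= 1.
Proof.
by rewrite /= in_itv/= normrX => s1; rewrite exprn_ile1// ler_norml.
Qed.

Lemma integrable_exp (mu : {finite_measure set R -> \bar R}) (n : nat) :
  mu.-integrable J (EFin \o (fun s : R => s ^+ n)).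
Proof.
apply: (@integrable_bounded _ _ _ _ _ _ 1) => //; last exact: norm_exp_itv.
Qed.

Lemma integral_exp_fin (mu : {finite_measure set R -> \bar R}) (n : nat) :
  (\int[mu]_(s in J) (s ^+ n)%:E)%E = (Rintegral mu J (fun s => s ^+ n))%:E.
Proof. by rewrite fineK// integrable_fin_num//; exact: integrable_exp. Qed.

Lemma psdk_moment (mu : probability R R) (phi : FG -> R) :
  (forall g, phi g = Rintegral mu J (fun s => s ^+ fgnorm2sq g)) ->
  psdk (fun x y => phi (fgmul (fginv x) y)).
Proof.
move=> phiE n c x; under eq_bigr do under eq_bigr do rewrite phiE.
rewrite pair_big /=.
have intf (p : 'I_n * 'I_n) :
  mu.-integrable J (EFin \o (fun s : R => s ^+ fgnorm2sq (fgmul (fginv (x p.1)) (x p.2)))).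
  exact: integrable_exp.
have [_ E] := RintegralM_sum (index_enum _) (fun p => c p.1 * c p.2) (measurable_itv _) intf.
rewrite -E; apply: Rintegral_ge0 => s; rewrite /= in_itv /= -ler_norml => s1.
by have := psdk_free_group s1 c x; rewrite pair_big.
Qed.
End moments.

(** * Determinacy of the moment problem *)

Section threshold.
Context {R : realType}.

Lemma expr_subr1_ge (x : R) (m : nat) : 0 <= x <= 1 -> 1 - m%:R * x <= (1 - x) ^+ m.
Proof.
move=> /andP[x0 x1]; elim: m => [|m IH]; first by rewrite mul0r subr0 expr0.
have IH' := ler_wpM2r (_ : 0 <= 1 - x) IH.
rewrite exprSr; apply: le_trans (IH' _); last by rewrite subr_ge0.
rewrite -natr1; have := mulr_ge0 (ler0n R m) (sqr_ge0 x); nra.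
Qed.

(** [1 - r ^ n] is [1 - r] times a sum of [n] powers of [r], each at least [r ^ n]. *)
Lemma natr_expr_bound (r : R) (n : nat) : 0 <= r <= 1 ->
  n%:R * r ^+ n * (1 - r) <= 1 - r ^+ n.
Proof.
move=> /andP[r0 r1]; elim: n => [|n IH]; first by rewrite !mul0r expr0 subrr.
have rn0 : 0 <= r ^+ n by rewrite exprn_ge0.
have rn1 : r ^+ n <= 1 by rewrite exprn_ile1.
rewrite -natr1 exprS.
have h1 := ler_wpM2l r0 IH.
have h2 : 0 <= (1 - r) * (1 - r * r ^+ n).
  by rewrite mulr_ge0 ?subr_ge0// mulr_ile1.
lra.
Qed.

Lemma cvg_natr_expr (r : R) : 0 <= r < 1 -> n%:R * r ^+ n @[n --> \oo] --> (0 : R).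
Proof.
(* With [r = q ^ 2], one factor [q ^ n] absorbs [n] and the other still decays. *)
move=> /andP[r0 r1]; pose q := Num.sqrt r.
have q0 : 0 <= q by exact: sqrtr_ge0.
have q1 : q < 1 by rewrite -[ltRHS]sqrtr1 ltr_sqrt.
have cvgq : (1 - q)^-1 * q ^+ n @[n --> \oo] --> (0 : R).
  by apply: cvg_geometric; rewrite ger0_norm.
apply: (squeeze_cvgr _ (cvg_cst 0) cvgq).
apply: nearW => n; rewrite mulr_ge0 ?exprn_ge0//=.
rewrite -(sqr_sqrtr r0) -/q -exprM mulnC exprM expr2 mulrA.
rewrite ler_wpM2r ?exprn_ge0// -[leRHS]mul1r ler_pdivlMr ?subr_gt0//.
apply: le_trans (natr_expr_bound n _) _; first by rewrite q0 ltW.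
by rewrite lerBlDr lerDl exprn_ge0.
Qed.

(** Below [1/2], Bernoulli's inequality gives the lower bound [1 - n (2 t)^n]. From [1/2] on,
    [1 - x <= exp (- x)] gives the upper bound [exp (- n (2 t)^n) <= exp (- n)]. *)
Lemma cvg_threshold (t : R) : 0 <= t <= 1 ->
  (1 - t ^+ n) ^+ (n * 2 ^ n) @[n --> \oo] --> ((t < 2^-1)%R%:R : R).
Proof.
move=> /andP[t0 t1].
have tn0 n : 0 <= t ^+ n by rewrite exprn_ge0.
have tn1 n : t ^+ n <= 1 by rewrite exprn_ile1.
have ge0 n : 0 <= 1 - t ^+ n by rewrite subr_ge0.
have le1 n : 1 - t ^+ n <= 1 by rewrite lerBlDr lerDl.
have [th|th] := ltP t (2^-1).
  rewrite -[X in _ --> X]/(1 : R).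
  have c1 : 1 - n%:R * (2 * t) ^+ n @[n --> \oo] --> (1 : R).
    rewrite -[X in _ --> X]subr0; apply: cvgB; first exact: cvg_cst.
    by apply: cvg_natr_expr; rewrite mulr_ge0//=; move: th; lra.
  apply: (squeeze_cvgr _ c1 (cvg_cst (1 : R))); apply: nearW => n.
  rewrite exprn_ile1// andbT.
  have := @expr_subr1_ge (t ^+ n) (n * 2 ^ n).
  by rewrite tn0 tn1 natrM natrX -mulrA -exprMn; apply.
rewrite -[X in _ --> X]/(0 : R).
apply: (squeeze_cvgr _ (cvg_cst 0) (@cvg_harmonic R)); apply: nearW => n.
rewrite exprn_ge0//= /harmonic.
apply: (@le_trans _ _ (expR (- n%:R))); last first.
  by rewrite expRN lef_pV2 ?posrE ?expR_gt0// -natr1 addrC expR_ge1Dx.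
apply: (@le_trans _ _ (expR (- t ^+ n) ^+ (n * 2 ^ n))).
  by rewrite lerXn2r ?nnegrE ?expR_ge0// expR_ge1Dx.
rewrite -expRM_natl ler_expR mulrN lerN2 natrM natrX -mulrA -exprMn.
rewrite ler_peMr// exprn_ege1//; move: th; lra.
Qed.

End threshold.

Section moment_uniqueness.
Context {R : realType}.
Local Notation J := (`[(-1)%R, 1%R]%classic : set R).

Lemma integral_horner (mu : {finite_measure set R -> \bar R}) (p : {poly R}) :
  (\int[mu]_(s in J) (p.[s])%:E)%E =
  (\sum_(i < size p) p`_i * Rintegral mu J (fun s => s ^+ i))%:E.
Proof.
have [intp Ep] := RintegralM_sum (index_enum _) (fun i : 'I_(size p) => p`_i)
  (measurable_itv _) (fun i : 'I_(size p) => integrable_exp mu i).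
rewrite -Ep /Rintegral fineK ?integrable_fin_num//.
by apply: eq_integral => s _; rewrite horner_coef.
Qed.

(** The affine map sends [a] to [1/2]; the slope [1/4] keeps the image of [J] inside [[0, 1]], since
    points of [J] are at distance at most [2] from [a]. *)
Lemma cvg_integral_threshold (mu : probability R R) (a : R) : J a ->
  (\int[mu]_(s in J) ((1 - (2^-1 + (s - a) * 4^-1) ^+ n) ^+ (n * 2 ^ n))%:E)%E @[n --> \oo]
  --> mu (`]-oo, a[ `&` J).
Proof.
move=> Ja.
have t01 s : J s -> 0 <= 2^-1 + (s - a) * 4^-1 <= 1.
  by move: Ja; rewrite /= !in_itv/= => *; lra.
have [|||||_ _ /=] := @dominated_convergence _ _ _ mu J (measurable_itv _)
    (fun n s => ((1 - (2^-1 + (s - a) * 4^-1) ^+ n) ^+ (n * 2 ^ n))%:E)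
    (fun s => (\1_(`]-oo, a[%classic : set R) s)%:E) (cst 1%E).
- move=> n; apply/measurable_EFinP; apply: measurable_funX => //.
  apply: measurable_funB => //; apply: measurable_funX.
  apply: measurable_funD => //; apply: measurable_funM => //.
  exact: measurable_funB.
- by apply/measurable_EFinP; exact: measurable_indic.
- apply: aeW => s Js; apply: cvg_EFin; first exact: nearW.
  rewrite indicE /= (_ : (s \in _) = (2^-1 + (s - a) * 4^-1 < 2^-1)).
    exact/cvg_threshold/t01.
  by rewrite mem_setE in_itv/=; apply/idP/idP => ?; lra.
- exact: finite_measure_integrable_cst.
- apply: aeW => s n Js; rewrite /= lee_fin normrX exprn_ile1//.
  have /andP[t0 t1] := t01 s Js.
  rewrite ger0_norm ?subr_ge0 ?exprn_ile1//.
  by rewrite lerBlDr lerDl exprn_ge0.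
by rewrite integral_indic.
Qed.

Lemma probability_setIl (d : measure_display) (T : measurableType d) (mu : probability T R)
    (A B : set T) :
  measurable A -> measurable B -> mu B = 1%E -> mu A = mu (A `&` B).
Proof.
move=> mA mB muB1.
suff muAB : mu (A `\` B) = 0%E by rewrite -[RHS]add0e -muAB; exact: measureDI.
apply/eqP; rewrite eq_le measure_ge0 andbT.
have <- : mu (~` B) = 0%E by rewrite probability_setC// muB1 subee.
by apply: le_measure; rewrite ?inE; [exact: measurableD | exact: measurableC | move=> x []].
Qed.

(** Open left half-lines are a generating pi-system, and their masses are limits of integrals of
    polynomials. *)
Lemma moment_unique (mu1 mu2 : probability R R) :
  mu1 J = 1%E -> mu2 J = 1%E ->
  (forall n, Rintegral mu1 J (fun s => s ^+ n) = Rintegral mu2 J (fun s => s ^+ n)) ->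
  forall A : set R, measurable A -> mu1 A = mu2 A.
Proof.
move=> mu1J mu2J E12 A mA.
apply: (measure_unique (@RGenInftyO.G R) (fun k => `]-oo, k%:R[%classic)) => //.
- exact: RGenInftyO.measurableE.
- move=> _ _ [x ->] [y ->]; exists (Num.min x y); apply/seteqP; split => z /=.
    by rewrite !in_itv/= lt_min => -[-> ->].
  by rewrite !in_itv/= lt_min => /andP[].
- by move=> k; exists k%:R.
- rewrite -subTset => x _; exists (Num.truncn x).+1 => //=.
  by rewrite in_itv/= truncnS_gt.
- move=> _ [a ->].
  rewrite [LHS](probability_setIl _ _ mu1J)// [RHS](probability_setIl _ _ mu2J)//.
  have [Ja|nJa] := pselect (J a).
    have c1 := @cvg_integral_threshold mu1 a Ja.
    have c2 := @cvg_integral_threshold mu2 a Ja.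
    rewrite (_ : (fun n => _) = (fun n => (\int[mu2]_(s in J)
        ((1 - (2^-1 + (s - a) * 4^-1) ^+ n) ^+ (n * 2 ^ n))%:E)%E)) in c1.
      exact: (cvg_unique _ c1 c2).
    apply/funext => n.
    pose p : {poly R} := (1 - ((2^-1)%:P + ('X - a%:P) * (4^-1)%:P) ^+ n) ^+ (n * 2 ^ n).
    have pE s : (1 - (2^-1 + (s - a) * 4^-1) ^+ n) ^+ (n * 2 ^ n) = p.[s].
      by rewrite /p !hornerE.
    under eq_integral do rewrite pE.
    under [RHS]eq_integral do rewrite pE.
    by rewrite !integral_horner; under eq_bigr do rewrite E12.
  (* With [a] outside [J], the half-line either misses [J] or contains it. *)
  have [a1|a1] := leP a 1.
    suff -> : `]-oo, a[ `&` J = set0 by rewrite !measure0.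
    apply/seteqP; split => // x [] /=; move: nJa; rewrite /= !in_itv/= a1 andbT.
    move=> /negP; rewrite -ltNge => aN1 xa /andP[/le_lt_trans/(_ xa)/lt_trans/(_ aN1)].
    by rewrite ltxx.
  suff -> : `]-oo, a[ `&` J = J by rewrite mu1J mu2J.
  by apply/setIidr => x /=; rewrite !in_itv/= => /andP[_ /le_lt_trans]; apply.
- by move=> k; rewrite (le_lt_trans (probability_le1 _ _))// ltry.
Qed.

End moment_uniqueness.

(** * Hankel positivity *)

Section hankel.
Context {R : realType}.

Lemma reducedw_iota (p n : nat) : reducedw [seq (i, 1 : int) | i <- iota p n].
Proof.
rewrite /reducedw all_map; apply/andP; split; first by apply/allP => i _.
case: n => // n /=; elim: n p => //= n IH p.
by rewrite IH andbT neq_ltn leqnn.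
Qed.

(** The word [a_p a_(p+1) ...] with [n] letters: it realizes squared norm [n], and for distinct [p]
    nothing cancels in [x^-1 y]. *)
Definition staircase (p n : nat) : FG := exist (fun w => reducedw w) _ (reducedw_iota p n).

Lemma wnsq_staircase (p n : nat) : wnsq (sval (staircase p n)) = n.
Proof. by rewrite /= /wnsq -map_comp; elim: n p => //= n IH p; rewrite IH. Qed.

Lemma fgnorm2sq_staircase (p q m n : nat) : p != q ->
  fgnorm2sq (fgmul (fginv (staircase p m)) (staircase q n)) = (m + n)%N.
Proof.
move=> pq; rewrite fgnorm2sq_invmul wnsq_mulrev_hd ?wnsq_staircase//.
by case: m n => [|m] [|n].
Qed.

Lemma fgnorm2sq_mulVg (x : FG) : fgnorm2sq (fgmul (fginv x) x) = 0%N.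
Proof.
rewrite fgnorm2sq_invmul; elim: (sval x) => //= -[a k] w IH /=.
by rewrite eqxx addNr eqxx.
Qed.

Lemma sum_modn (d N : nat) (g : nat -> R) :
  \sum_(p < N * d) g (p %% d)%N = N%:R * \sum_(i < d) g i.
Proof.
rewrite -(big_mkord xpredT (fun p => g (p %% d)%N)) -(big_mkord xpredT g).
elim: N => [|N IH]; first by rewrite mul0n big_geq// mul0r.
rewrite mulSn (@big_cat_nat _ _ _ d)//= ?leq_addr// -natr1 mulrDl mul1r addrC.
congr (_ + _).
  rewrite -{1}[d]add0n big_addn addKn -IH.
  by apply: eq_bigr => i _; rewrite modnDr.
by apply: eq_big_nat => i /andP[_ id]; rewrite modn_small.
Qed.

Variables (phi : FG -> R) (f : nat -> R).
Hypothesis phiE : forall g, phi g = f (fgnorm2sq g).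
Hypothesis psd_phi : psdk (fun x y => phi (fgmul (fginv x) y)).

(* Many copies of the configuration with distinct first letters make the diagonal terms, where
   cancellation occurs, negligible against the off-diagonal ones. *)
Lemma hankel_ge0 (d : nat) (c : nat -> R) :
  0 <= \sum_(i < d) \sum_(j < d) c i * c j * f (i + j)%N.
Proof.
set H := \sum_(i < d) _.
(* [E] is the diagonal error of one copy: cancellation yields [f 0] in place of [f (i + i)]. *)
pose E := \sum_(i < d) c i * c i * (f 0%N - f (i + i)%N).
have HE (N : nat) : 0 <= N%:R * (N%:R * H + E).
  have := psd_phi (fun p : 'I_(N * d) => c (p %% d)%N) (fun p => staircase p (p %% d)%N).
  congr (0 <= _).
  transitivity (\sum_(p < N * d) (N%:R * (\sum_(j < d) c (p %% d)%N * c j * f (p %% d + j)%N) +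
      c (p %% d)%N * c (p %% d)%N * (f 0%N - f (p %% d + p %% d)%N))).
    apply: eq_bigr => p _.
    rewrite -(sum_modn d N (fun j => c (p %% d)%N * c j * f (p %% d + j)%N)).
    rewrite [LHS](bigD1 p)//= [in RHS](bigD1 p)//= phiE fgnorm2sq_mulVg.
    rewrite [RHS]addrAC -mulrDr [_ + (_ - _)]addrC subrK; congr (_ + _).
    apply: eq_bigr => q qp; rewrite phiE fgnorm2sq_staircase// eq_sym.
    by apply: contra qp => /eqP qp; apply/eqP/val_inj.
  rewrite (sum_modn d N (fun i => N%:R * (\sum_(j < d) c i * c j * f (i + j)%N) +
      c i * c i * (f 0%N - f (i + i)%N))).
  by rewrite big_split -mulr_sumr.
rewrite leNgt; apply/negP => H0.
(* If [H < 0], this many copies make [N * H + E] negative. *)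
pose N := (Num.truncn (`|E| / - H)).+1.
have NH : `|E| < N%:R * - H by rewrite -ltr_pdivrMr ?oppr_gt0// truncnS_gt.
have := HE N; rewrite pmulr_rge0 ?ltr0n// leNgt => /negP; apply.
by rewrite -ltrBrDr add0r ltrNr -mulrN (le_lt_trans (ler_norm _)).
Qed.

(** Two test points suffice, the identity and a word of squared norm [n], with coefficients [1] and
    [e = 1] or [-1]. *)
Lemma moment_norm_le (n : nat) : `|f n| <= f 0%N.
Proof.
have pm (e : R) : e * e = 1 -> 0 <= (f 0%N + e * f n) *+ 2.
  move=> e2.
  have := psd_phi (n := 2) (fun i => if i == ord0 then 1 else e)
    (fun i => if i == ord0 then staircase 0 0 else staircase 1 n).
  congr (0 <= _); rewrite !big_ord_recl !big_ord0 /= !phiE !fgnorm2sq_mulVg.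
  by rewrite !fgnorm2sq_staircase// addn0 add0n e2; ring.
have h1 := pm 1 (mulr1 1).
have h2 : 0 <= (f 0%N + -1 * f n) *+ 2 by apply: pm; rewrite mulrNN mulr1.
by rewrite ler_norml; apply/andP; split; lra.
Qed.

End hankel.

(** * Bernstein weights *)

(** These are the factorial moments of the binomial law. The ring is general because [x] and [y]
    will be polynomials. *)
Lemma sum_ffact_binomial (A : comNzRingType) (x y : A) (n j : nat) : x + y = 1 ->
  \sum_(k < n.+1) (x ^+ k * y ^+ (n - k)) *+ ((k ^_ j) * 'C(n, k)) = x ^+ j *+ (n ^_ j).
Proof.
move=> xy; elim: j n => [|j IH] n.
  rewrite ffactn0 expr0 mulr1n -(expr1n A n) -xy addrC exprDn.
  by apply: eq_bigr => k _; rewrite ffactn0 mul1n mulrC.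
case: n => [|n]; first by rewrite big_ord1 ffact0n mul0n !mulr0n.
rewrite big_ord_recl /= ffact0n mul0n mulr0n add0r ffactSS mulnC mulrnA exprS.
rewrite -mulrnAr -IH mulr_sumr -sumrMnl; apply: eq_bigr => i _.
rewrite /bump /= add1n ffactSS subSS mulrnAr -mulrnA mulrA -exprS.
by congr (_ *+ _); rewrite mulnAC -mul_bin_diag /=; ring.
Qed.

(** The left ratio is a product of factors [(k - i) / (n - i)] in [[0, 1]], each within [i / n] of
    [k / n]; the errors of the factors add up. *)
Lemma ffact_ratio_dist (R : realFieldType) (n k j : nat) :
  (k <= n)%N -> (j <= n)%N -> (0 < n)%N ->
  `|(k ^_ j)%:R / (n ^_ j)%:R - (k%:R / n%:R) ^+ j| <= (j ^ 2)%:R / n%:R :> R.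
Proof.
move=> kn + n0; elim: j => [|j IH] jn.
  by rewrite !ffactn0 expr0 divr1 subrr normr0 mul0r.
have {}IH := IH (ltnW jn).
have n0R : 0 < n%:R :> R by rewrite ltr0n.
have nj0 : 0 < (n - j)%:R :> R by rewrite ltr0n subn_gt0.
rewrite !ffactnSr [(k ^_ j * _)%:R]natrM [(n ^_ j * _)%:R]natrM exprSr invfM mulrACA.
set u := (k ^_ j)%:R / _ in IH *; set v := (k%:R / n%:R) ^+ j in IH *.
set y := k%:R / n%:R; set x := (k - j)%:R / (n - j)%:R.
have x01 : 0 <= x <= 1.
  by rewrite divr_ge0//= ler_pdivrMr// mul1r ler_nat leq_sub2r.
have y01 : 0 <= y <= 1 by rewrite divr_ge0//= ler_pdivrMr// mul1r ler_nat.
have v01 : 0 <= v <= 1 by case/andP: y01 => *; rewrite exprn_ge0//= exprn_ile1.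
have xy : `|x - y| <= j%:R / n%:R.
  (* For [k <= j] the truncated subtraction makes [x] zero. *)
  have [kj|jk] := leqP k j.
    rewrite /x (eqP (_ : (k - j)%N == 0%N)) ?subn_eq0// mul0r sub0r normrN.
    rewrite ger0_norm; last by case/andP: y01.
    by rewrite ler_pM2r ?invr_gt0// ler_nat.
  have -> : x - y = - (j%:R / n%:R * ((n - k)%:R / (n - j)%:R)).
    rewrite /x /y !natrB// 1?ltnW//; field.
    by rewrite -natrB 1?ltnW// !gt_eqF.
  rewrite normrN ger0_norm ?mulr_ge0 ?divr_ge0// ler_piMr ?divr_ge0//.
  by rewrite ler_pdivrMr// mul1r ler_nat leq_sub2l// ltnW.
have -> : u * x - v * y = (u - v) * x + v * (x - y) by ring.
apply: (le_trans (ler_normD _ _)); rewrite [`|_ * x|]normrM [`|v * _|]normrM.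
have h1 : `|u - v| * `|x| <= (j ^ 2)%:R / n%:R.
  by apply: le_trans IH; rewrite ler_piMr// ger0_norm; case/andP: x01.
have h2 : `|v| * `|x - y| <= j%:R / n%:R.
  by apply: le_trans xy; rewrite ler_piMl// ger0_norm; case/andP: v01.
apply: (le_trans (lerD h1 h2)); rewrite -mulrDl -natrD ler_pM2r ?invr_gt0// ler_nat.
by rewrite -!mulnn mulSn mulnS [(j * j + j)%N]addnC leq_addl.
Qed.

(** * The moment functional and its Bernstein weights *)

Section moment_functional.
Context {R : realType}.
Variable f : nat -> R.

Definition momf (p : {poly R}) : R := \sum_(i < size p) p`_i * f i.

Lemma momf_widen (n : nat) (p : {poly R}) : (size p <= n)%N ->
  momf p = \sum_(i < n) p`_i * f i.
Proof.
move=> pn; rewrite /momf (big_ord_widen n (fun i => p`_i * f i) pn) [LHS]big_mkcond.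
by apply: eq_bigr => i _; case: ltnP => // /leq_sizeP -> //; rewrite mul0r.
Qed.

Lemma momf_is_scalar : scalar momf.
Proof.
move=> a p q; pose n := maxn (size (a *: p + q)) (maxn (size p) (size q)).
rewrite !(@momf_widen n) ?leq_max ?leqnn ?orbT// mulr_sumr -big_split.
by apply: eq_bigr => i _; rewrite coefD coefZ mulrDl mulrA.
Qed.

HB.instance Definition _ :=
  GRing.isLinear.Build R {poly R} R *%R momf momf_is_scalar.

Lemma momfXn (n : nat) : momf 'X^n = f n.
Proof.
rewrite /momf size_polyXn big_ord_recr /= coefXn eqxx mul1r big1 ?add0r// => i _.
by rewrite coefXn ltn_eqF ?mul0r// ltn_ord.
Qed.

Lemma momfXnM (n : nat) (p : {poly R}) :
  momf ('X^n * p) = \sum_(i < size p) p`_i * f (n + i)%N.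
Proof.
rewrite -{1}[p]coefK poly_def mulr_sumr linear_sum; apply: eq_bigr => i _.
by rewrite -scalerAr -exprD linearZ /= momfXn.
Qed.

Hypothesis hankel_f : forall (d : nat) (c : nat -> R),
  0 <= \sum_(i < d) \sum_(j < d) c i * c j * f (i + j)%N.
Hypothesis f_le1 : forall n, `|f n| <= 1.

Lemma momf_sqr_ge0 (q : {poly R}) : 0 <= momf (q * q).
Proof.
have := hankel_f (size q) (fun i => q`_i); congr (0 <= _).
transitivity (momf ((\sum_(i < size q) q`_i *: 'X^i) * q)); last by rewrite -poly_def coefK.
rewrite mulr_suml linear_sum; apply: eq_bigr => i _.
rewrite -scalerAl linearZ /= momfXnM mulr_sumr; apply: eq_bigr => j _.
by rewrite mulrA.
Qed.

Let a (q : {poly R}) (n : nat) : R := momf ('X^n * (q * q)).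

(** This is Cauchy-Schwarz as a quadratic form, from positivity on the square of [(x X^n + y) q]. *)
Let a_CS (q : {poly R}) (n : nat) (x y : R) :
  0 <= x ^+ 2 * a q (n + n)%N + 2 * x * y * a q n + y ^+ 2 * a q 0%N.
Proof.
have := momf_sqr_ge0 ((x *: 'X^n + y%:P) * q); congr (0 <= _).
have -> : (x *: 'X^n + y%:P) * q * ((x *: 'X^n + y%:P) * q) =
    x ^+ 2 *: ('X^(n + n) * (q * q)) + (2 * x * y) *: ('X^n * (q * q)) +
    y ^+ 2 *: ('X^0 * (q * q)).
  by rewrite -!mul_polyC exprD !(polyCM, polyC_exp) expr0; ring.
by rewrite !linearD !linearZ.
Qed.

(** Cauchy-Schwarz gives [a_n^2 <= a_0 a_(2n)], so an excess of [|a_n|] over [a_0] would grow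
    without bound along [n 2^k], whereas [|f| <= 1] bounds the sequence by [C]. *)
Lemma momf_norm_le (q : {poly R}) (n : nat) : `|a q n| <= a q 0%N.
Proof.
have a0 : 0 <= a q 0%N by rewrite /a mul1r momf_sqr_ge0.
pose C := \sum_(i < size (q * q)) `|(q * q)`_i|.
have aC m : `|a q m| <= C.
  rewrite /a momfXnM (le_trans (ler_norm_sum _ _ _))// ler_sum// => i _.
  by rewrite normrM ler_piMr.
rewrite leNgt; apply/negP => lt_a.
pose e := `|a q n| - a q 0%N.
have e0 : 0 < e by rewrite subr_gt0.
have {}a0 : 0 < a q 0%N.
  rewrite lt_neqAle a0 andbT; apply/eqP => a00; move: lt_a; rewrite -a00 => an.
  have an0 : a q n != 0 by rewrite -normr_gt0.
  (* When [a q 0] vanishes the form is affine in [y], and this [y] makes it equal to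
     [a q (n + n) - |a q (n + n)| - 1 < 0]. *)
  have := @a_CS q n 1 (- (`|a q (n + n)%N| + 1) / (2 * a q n)).
  rewrite -a00 mulr0 addr0 expr1n mul1r mulr1 leNgt => /negP; apply.
  have -> : 2 * (- (`|a q (n + n)%N| + 1) / (2 * a q n)) * a q n = - (`|a q (n + n)%N| + 1).
    by field.
  by rewrite -ltrBrDr sub0r opprK (le_lt_trans (ler_norm _))// ltrDl.
have grow k : a q 0%N + k.+1%:R * e <= `|a q (n * 2 ^ k)%N|.
  elim: k => [|k IH]; first by rewrite mul1r muln1 addrC subrK.
  rewrite expnS mul2n -addnn mulnDr; set m := (n * 2 ^ k)%N in IH *.
  have := a_CS q m (a q 0%N) (- a q m).
  have -> : a q 0%N ^+ 2 * a q (m + m)%N + 2 * a q 0%N * - a q m * a q m +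
      (- a q m) ^+ 2 * a q 0%N = a q 0%N * (a q 0%N * a q (m + m)%N - `|a q m| ^+ 2).
    by rewrite real_normK ?num_real//; ring.
  rewrite pmulr_rge0// subr_ge0 => CS.
  apply: le_trans (ler_norm _); rewrite -(ler_pM2l a0); apply: le_trans CS.
  have k0 : 0 <= k%:R :> R by exact: ler0n.
  have ke : 0 <= k%:R * e by rewrite mulr_ge0// ltW.
  have sq : (a q 0%N + k.+1%:R * e) ^+ 2 <= `|a q m| ^+ 2.
    by rewrite lerXn2r ?nnegrE// addr_ge0 ?mulr_ge0// ltW.
  apply: le_trans sq; rewrite -!natr1 expr2.
  have := mulr_ge0 (ltW a0) ke; have := mulr_gt0 a0 e0; have := sqr_ge0 (k%:R * e + e).
  lra.
pose k := Num.truncn (C / e).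
have := le_trans (grow k) (aC _); apply/negP; rewrite -ltNge.
have : C < k.+1%:R * e by rewrite -ltr_pdivrMr// truncnS_gt.
by move=> /lt_trans; apply; rewrite ltrDr.
Qed.

(** Even powers form a square; the remaining factor is [1], [1 + X], [1 - X] or [1 - X^2], handled
    by the bounds on [a q 1] and [a q 2]. *)
Lemma momf_bernstein_ge0 (k m : nat) : 0 <= momf ((1 + 'X) ^+ k * (1 - 'X) ^+ m).
Proof.
have L1 (q : {poly R}) : 0 <= momf ((1 + 'X) * (q * q)).
  have := momf_norm_le q 1; rewrite /a ler_norml => /andP[h _].
  by rewrite mulrDl linearD /= addrC -lerBlDr sub0r; exact: h.
have L2 (q : {poly R}) : 0 <= momf ((1 - 'X) * (q * q)).
  have := momf_norm_le q 1; rewrite /a ler_norml => /andP[_ h].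
  by rewrite mulrBl linearB /= subr_ge0; exact: h.
have L3 (q : {poly R}) : 0 <= momf ((1 + 'X) * (1 - 'X) * (q * q)).
  have := momf_norm_le q 2; rewrite /a ler_norml => /andP[_ h].
  rewrite (_ : (1 + 'X) * (1 - 'X) = 'X^0 - 'X^2); last by rewrite expr0; ring.
  by rewrite mulrBl linearB subr_ge0.
rewrite -(odd_double_half k) -(odd_double_half m) -!addnn !exprD.
set p := (1 + 'X) ^+ k./2; set r := (1 - 'X) ^+ m./2.
case: (odd k); case: (odd m) => /=; rewrite ?expr0 ?expr1 ?mul1r.
- by have := L3 (p * r); congr (0 <= momf _); ring.
- by have := L1 (p * r); congr (0 <= momf _); ring.
- by have := L2 (p * r); congr (0 <= momf _); ring.
- by have := momf_sqr_ge0 (p * r); congr (0 <= momf _); ring.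
Qed.

(** The functional at the Bernstein polynomial ['C(n, k) t^k (1 - t)^(n - k)] with
    [t = (1 + X) / 2]. *)
Definition bernw (n k : nat) : R :=
  'C(n, k)%:R * 2 ^- n * momf ((1 + 'X) ^+ k * (1 - 'X) ^+ (n - k)).

Lemma bernw_ge0 (n k : nat) : 0 <= bernw n k.
Proof. by rewrite mulr_ge0 ?momf_bernstein_ge0// divr_ge0// exprn_ge0. Qed.

Let T : {poly R} := 2^-1 *: (1 + 'X).

Lemma sum_ffact_bernw (n j : nat) :
  \sum_(k < n.+1) (k ^_ j)%:R * bernw n k = (n ^_ j)%:R * momf (T ^+ j).
Proof.
have TS : T + 2^-1 *: (1 - 'X) = 1.
  rewrite -scalerDr addrACA subrr addr0 -mulr2n -(scaler_nat 2 (1 : {poly R})).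
  by rewrite scalerA mulVf// scale1r.
have TSE (k : 'I_n.+1) : T ^+ k * (2^-1 *: (1 - 'X)) ^+ (n - k) =
    2 ^- n *: ((1 + 'X) ^+ k * (1 - 'X) ^+ (n - k)).
  by rewrite /T !exprZn -scalerAl -scalerAr scalerA -exprD subnKC -1?ltnS// exprVn.
rewrite mulr_natl -raddfMn -(sum_ffact_binomial n j TS) raddf_sum /=.
apply: eq_bigr => k _; rewrite raddfMn /= TSE linearZ /= -[RHS]mulr_natl natrM /bernw.
by ring.
Qed.

Lemma sum_bernw (n : nat) : f 0%N = 1 -> \sum_(k < n.+1) bernw n k = 1.
Proof.
move=> f0; have := sum_ffact_bernw n 0.
rewrite !ffactn0 mul1r expr0 -(expr0 'X) momfXn f0 => <-.
by apply: eq_bigr => k _; rewrite ffactn0 mul1r.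
Qed.

(** Normalized factorial moments are exact as soon as [j <= n + 1]; passing to ordinary powers costs
    at most [j^2 / (n + 1)] since the weights have sum [1]. *)
Lemma cvg_bernw_pow (j : nat) : f 0%N = 1 ->
  \sum_(k < n.+2) bernw n.+1 k * (k%:R / n.+1%:R) ^+ j @[n --> \oo] --> momf (T ^+ j).
Proof.
move=> f0; pose l := momf (T ^+ j).
have h0 : (j ^ 2)%:R * @harmonic R n @[n --> \oo] --> (0 : R).
  by rewrite -[X in _ --> X](mulr0 (j ^ 2)%:R); apply: cvgMr; exact: cvg_harmonic.
have lo : l - (j ^ 2)%:R * @harmonic R n @[n --> \oo] --> l.
  by rewrite -[X in _ --> X]subr0; apply: cvgB h0; exact: cvg_cst.
have hi : l + (j ^ 2)%:R * @harmonic R n @[n --> \oo] --> l.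
  by rewrite -[X in _ --> X]addr0; apply: cvgD h0; exact: cvg_cst.
apply: (squeeze_cvgr _ lo hi); near=> n.
have jn : (j <= n.+1)%N by near: n; exists j => // m /= /leqW.
rewrite -ler_distl distrC.
have nj0 : (n.+1 ^_ j)%:R != 0 :> R by rewrite pnatr_eq0 -lt0n ffact_gt0.
have -> : l = \sum_(k < n.+2) bernw n.+1 k * ((k ^_ j)%:R / (n.+1 ^_ j)%:R).
  apply: (mulfI nj0); rewrite -sum_ffact_bernw mulr_sumr; apply: eq_bigr => k _.
  by field.
rewrite -sumrB; apply: (le_trans (ler_norm_sum _ _ _)).
have -> : (j ^ 2)%:R * harmonic n = \sum_(k < n.+2) bernw n.+1 k * ((j ^ 2)%:R * harmonic n).
  by rewrite -mulr_suml sum_bernw// mul1r.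
rewrite ler_sum// => k _.
rewrite -mulrBr normrM ger0_norm ?bernw_ge0// ler_wpM2l ?bernw_ge0//.
by apply: ffact_ratio_dist => //; rewrite -ltnS.
Unshelve. all: by end_near. Qed.

Lemma cvg_bernw_moment (j : nat) : f 0%N = 1 ->
  \sum_(k < n.+2) bernw n.+1 k * (2 * (k%:R / n.+1%:R) - 1) ^+ j @[n --> \oo] --> f j.
Proof.
(* [p] maps the nodes from [[0, 1]] back to [[-1, 1]], and [p \Po T] is [X^j]. *)
move=> f0; pose p : {poly R} := (2 *: 'X - 1) ^+ j.
have <- : momf (p \Po T) = f j.
  rewrite -momfXn; congr momf.
  rewrite /p rmorphXn /= rmorphB /= linearZ /= comp_polyX rmorph1 /T.
  by rewrite scalerA mulfV// scale1r addrC addKr.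
have -> : momf (p \Po T) = \sum_(i < size p) p`_i * momf (T ^+ i).
  by rewrite comp_polyE linear_sum; apply: eq_bigr => i _; rewrite linearZ.
have : \sum_(i < size p) p`_i * \sum_(k < n.+2) bernw n.+1 k * (k%:R / n.+1%:R) ^+ i @[n --> \oo]
    --> \sum_(i < size p) p`_i * momf (T ^+ i).
  apply: cvg_big => [|i _]; first exact: add_continuous.
  by apply: cvgMr; exact: cvg_bernw_pow.
apply: cvg_trans; apply: near_eq_cvg; apply: nearW => n.
under eq_bigr do rewrite mulr_sumr; rewrite exchange_big /=; apply: eq_bigr => k _.
transitivity (bernw n.+1 k * p.[k%:R / n.+1%:R]); last by rewrite /p !hornerE.
by rewrite horner_coef mulr_sumr; apply: eq_bigr => i _; rewrite mulrCA.
Qed.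

End moment_functional.

(** * Weak limits of discrete probabilities *)

Section probability_of_cdf.
Context {R : realType}.
Variable F : R -> R.
Hypothesis F_nd : {homo F : x y / x <= y}.
Hypothesis F_rc : forall x, F @ x^'+ --> F x.
Hypothesis F_Ny : F @ -oo --> (0 : R).
Hypothesis F_y : F @ +oo --> (1 : R).

#[local] HB.instance Definition _ := isCumulative.Build R _ R F F_nd F_rc.
#[local] HB.instance Definition _ := isCumulativeBounded.Build R 0 1 F F_Ny F_y.

(** The identity as a random variable: its law carries the Lebesgue-Stieltjes measure over to
    [R]. *)
Let idTR : measurableTypeR R -> R := idfun.

#[local] HB.instance Definition _ :=
  @isMeasurableFun.Build _ _ _ _ idTR (@measurable_id _ _ setT).

Lemma exists_probability_cdf :
  exists P : probability R R, forall r : R, P `]-oo, r]%classic = (F r)%:E.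
Proof.
exists (distribution (lebesgue_stieltjes_measure F)
  (idTR : {RV (lebesgue_stieltjes_measure F) >-> R})).
by move=> r; exact: (cdf_lebesgue_stieltjes_id F r).
Qed.

End probability_of_cdf.

Section ultralimit.
Context {R : realType} (T : Type) (U : set_system T) (UU : UltraFilter U).

Lemma ultra_cvg_bounded (u : T -> R) (M : R) :
  (forall t, `|u t| <= M) -> exists l : R, u @ U --> l.
Proof.
move=> uM.
have UF : ProperFilter U by exact: ultra_proper.
have [|l [_ lcl]] := @segment_compact R (- M) M (u @ U) _.
  by apply: (@filterE _ U) => t; rewrite /= in_itv/= -ler_norml.
(* An ultrafilter contains the preimage of [B] or of its complement; the latter contradicts that [l]
   is a cluster point. *)
exists l => B Bl; have [//|UB] := in_ultra_setVsetC (u @^-1` B) UU.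
by have [x [nB Bx]] := lcl (~` B) B UB Bl.
Qed.

End ultralimit.

(* By bisection: the bound is halved at each step. *)
Lemma slow_growth_cst (R : realType) (E V : R -> R) (C A B : R) :
  (forall a b, A <= a -> a <= b -> b <= B -> `|E b - E a| <= C * (b - a) * (V b - V a)) ->
  A <= B -> E A = E B.
Proof.
move=> slow AB.
have bis n a b : A <= a -> a <= b -> b <= B ->
    `|E b - E a| <= C * (b - a) / 2 ^+ n * (V b - V a).
  elim: n a b => [|n IH] a b Aa ab bB; first by rewrite divr1 slow.
  pose m := (a + b) / 2.
  have [am mb] : a <= m /\ m <= b by rewrite /m; split; lra.
  have h1 := IH a m Aa am (le_trans mb bB).
  have h2 := IH m b (le_trans Aa am) mb bB.
  rewrite -(subrKA (E m)); apply: (le_trans (ler_normD _ _)).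
  apply: (le_trans (lerD h2 h1)).
  have -> : b - m = (b - a) / 2 by rewrite /m; lra.
  have -> : m - a = (b - a) / 2 by rewrite /m; lra.
  rewrite -mulrDr subrKA exprS invfM le_eqVlt; apply/orP; left; apply/eqP.
  by ring.
apply/eqP; rewrite -subr_eq0 -normr_le0 distrC.
have cv : C * (B - A) * (V B - V A) * 2^-1 ^+ n @[n --> \oo] --> (0 : R).
  by apply: cvg_geometric; rewrite ger0_norm; lra.
rewrite -(cvg_lim _ cv)//; apply: limr_ge; first by apply/cvg_ex; eexists; exact: cv.
apply: nearW => n; have := bis n A B (lexx _) AB (lexx _).
by rewrite exprVn; congr (_ <= _); ring.
Qed.

Lemma right_regularization (R : realType) (G : R -> R) :
  {homo G : x y / x <= y} -> (forall x, 0 <= G x) ->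
  exists F : R -> R, [/\ {homo F : x y / x <= y}, (forall x, F @ x^'+ --> F x),
    (forall x, G x <= F x) & (forall x y, x < y -> F x <= G y)].
Proof.
(* [F x] is the right limit of [G] at [x]. *)
move=> Gnd G0; pose F x := inf [set G y | y in `]x, +oo[%classic].
have ne x : [set G y | y in `]x, +oo[%classic] !=set0.
  by exists (G (x + 1)), (x + 1) => //=; rewrite in_itv/= andbT ltrDl.
have lb x : has_lbound [set G y | y in `]x, +oo[%classic] by exists 0 => _ [y _ <-].
have FG x y : x < y -> F x <= G y.
  by move=> xy; apply: ge_inf => //; exists y => //=; rewrite in_itv/= andbT.
have GF x : G x <= F x.
  by apply: lb_le_inf => // r [y /=]; rewrite in_itv/= andbT => xy <-; exact/Gnd/ltW.
have Fnd : {homo F : x y / x <= y}.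
  move=> x y xy; apply: lb_le_inf => // r [t /=]; rewrite in_itv/= andbT => yt <-.
  by apply: FG; exact: le_lt_trans yt.
exists F; split => // x; apply/cvgrPdist_le => e e0.
have [r [y /= xy rE] Gy] := inf_adherent e0 (conj (ne x) (lb x)).
move: xy; rewrite in_itv/= andbT => xy.
rewrite -rE in Gy.
near=> t.
have xt : x < t by near: t; exact: nbhs_right_gt.
have ty : t < y by near: t; exact: nbhs_right_lt.
have Fxt : F x <= F t by apply/Fnd/ltW.
rewrite distrC ger0_norm ?subr_ge0// lerBlDl.
by apply/ltW/(le_lt_trans (FG _ _ ty)).
Unshelve. all: by end_near. Qed.

Section helly.
Context {R : realType}.
Local Notation J := (`[(-1)%R, 1%R]%classic : set R).
Variables (K : nat -> nat) (w z : nat -> nat -> R).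
Hypothesis w0 : forall n k, 0 <= w n k.
Hypothesis w1 : forall n, \sum_(k < K n) w n k = 1.
Hypothesis zJ : forall n k, (k < K n)%N -> -1 <= z n k <= 1.

(** The integral of [h] up to [x] against the [n]-th discrete probability; [h = cst 1] gives its
    distribution function. *)
Let Sn (h : R -> R) (n : nat) (x : R) : R :=
  \sum_(k < K n | z n k <= x) w n k * h (z n k).

Let SnE (h : R -> R) (n : nat) (x : R) :
  Sn h n x = \sum_(k < K n) if z n k <= x then w n k * h (z n k) else 0.
Proof. exact: big_mkcond. Qed.

Let Sn_bound (h : R -> R) (M : R) (n : nat) (x : R) :
  (forall y, -1 <= y <= 1 -> `|h y| <= M) -> `|Sn h n x| <= M.
Proof.
move=> hM; have M0 : 0 <= M by apply: le_trans (hM 0 _) => //; lra.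
rewrite (le_trans (ler_norm_sum _ _ _))// -[leRHS]mul1r -(w1 n) mulr_suml.
rewrite big_mkcond ler_sum// => k _; case: ifP => _; last by rewrite mulr_ge0.
by rewrite normrM ger0_norm// ler_wpM2l// hM// zJ.
Qed.

Let Sn_lo (h : R -> R) (n : nat) (x : R) : x < -1 -> Sn h n x = 0.
Proof.
move=> x1; rewrite /Sn big_pred0// => k; apply/negbTE; rewrite -ltNge (lt_le_trans x1)//.
by have /andP[] := zJ (ltn_ord k).
Qed.

Let Sn_hi (h : R -> R) (n : nat) (x : R) : 1 <= x ->
  Sn h n x = \sum_(k < K n) w n k * h (z n k).
Proof.
move=> x1; apply: eq_bigl => k; apply: le_trans x1.
by have /andP[] := zJ (ltn_ord k).
Qed.

(** Only nodes in []a, b]] contribute, and there [h] is within [C (b - a)] of [h b]. *)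
Let Sn_incr (h : R -> R) (C : R) (n : nat) (a b : R) : -2 <= a -> a <= b -> b <= 1 ->
  (forall x y, -2 <= x <= 1 -> -2 <= y <= 1 -> `|h x - h y| <= C * `|x - y|) ->
  `|Sn h n b - Sn h n a - h b * (Sn (cst 1) n b - Sn (cst 1) n a)| <=
  C * (b - a) * (Sn (cst 1) n b - Sn (cst 1) n a).
Proof.
move=> a2 ab b1 hC.
have C0 : 0 <= C.
  have := le_trans (normr_ge0 _) (hC 1 0 _ _).
  by rewrite subr0 normr1 mulr1; apply; lra.
rewrite !SnE -!sumrB !mulr_sumr -sumrB.
rewrite (le_trans (ler_norm_sum _ _ _))// ler_sum// => k _.
rewrite mulr1; have zk := zJ (ltn_ord k); have wk := w0 n k.
have [za|za] := leP (z n k) a.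
  by rewrite (le_trans za ab) !subrr !mulr0 subrr normr0.
have [zb|zb] := leP (z n k) b; last by rewrite !subrr !mulr0 subrr normr0.
rewrite !subr0 [h b * _]mulrC -mulrBr normrM ger0_norm// [leRHS]mulrC ler_wpM2l//.
apply: (le_trans (hC _ _ _ _)); [lra|lra|].
rewrite ler_wpM2l// ler_norml; lra.
Qed.

(** Ultrafilter limits exist at every [x], so no subsequence is extracted. Comparing [[-2, x]]
    integrals of [h] for the limit and for [mu] yields a function whose increments are too small for
    it to vary; [-2] is a starting point left of all mass. *)
Lemma helly : exists2 mu : probability R R, mu J = 1%E &
  forall (h : R -> R) (C l : R), measurable_fun setT h ->
  (forall x y, -2 <= x <= 1 -> -2 <= y <= 1 -> `|h x - h y| <= C * `|x - y|) ->
  \sum_(k < K n) w n k * h (z n k) @[n --> \oo] --> l ->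
  Rintegral mu J h = l.
Proof.
have N21 : -2 <= 1 :> R by lra.
have N2 : -2 < -1 :> R by lra.
have [U [UU sU]] := @ultraFilterLemma _ \oo _.
have UF : ProperFilter U by exact: ultra_proper.
have cvS (h : R -> R) (M : R) : (forall y, -1 <= y <= 1 -> `|h y| <= M) ->
    {S : R -> R & forall x, Sn h n x @[n --> U] --> S x}.
  move=> hM.
  have cvx x : exists l : R, Sn h n x @[n --> U] --> l.
    by apply: (@ultra_cvg_bounded _ _ _ UU _ M) => n; exact: Sn_bound.
  by exists (fun x => projT1 (cid (cvx x))) => x; case: (cid (cvx x)).
have [y _|G Gcv] := cvS (cst 1) 1; first by rewrite normr1.
have Gcst x c : (forall n, Sn (cst 1) n x = c) -> G x = c.
  move=> Sc; have := Gcv x; rewrite (_ : (fun n => _) = cst c); last exact/funext.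
  by move=> /cvg_unique; apply => //; exact: cvg_cst.
have Glo x : x < -1 -> G x = 0 by move=> x1; apply: Gcst => n; exact: Sn_lo.
have Ghi x : 1 <= x -> G x = 1.
  move=> x1; apply: Gcst => n; rewrite Sn_hi// -[RHS](w1 n).
  by apply: eq_bigr => k _; rewrite mulr1.
have Gnd : {homo G : x y / x <= y}.
  move=> x y xy; apply: (ler_cvg_to (Gcv x) (Gcv y)); apply: filterE => n.
  rewrite !SnE ler_sum// => k _; rewrite mulr1.
  have [zx|zx] := leP (z n k) x; first by rewrite (le_trans zx xy).
  by case: ifP.
have G0 x : 0 <= G x.
  have := Gnd (Num.min x (-2)) x; rewrite Glo ?gt_min; last by apply/orP; right; lra.
  by apply; rewrite ge_min lexx.
have [F [Fnd Frc GF FG]] := right_regularization Gnd G0.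
have Flo x : x < -1 -> F x = 0.
  move=> x1; apply/eqP; rewrite eq_le (le_trans (G0 x))// andbT.
  by rewrite -(Glo ((x - 1) / 2)) ?FG//; lra.
have Fhi x : 1 <= x -> F x = 1.
  move=> x1; apply/eqP; rewrite eq_le -{2}(Ghi x x1) GF andbT.
  by rewrite -(Ghi (x + 1)) ?FG//; lra.
have [||mu muF] := @exists_probability_cdf R F Fnd Frc.
- by apply: cvg_near_cst; near=> x; apply: Flo; near: x; exact: nbhs_ninfty_lt.
- by apply: cvg_near_cst; near=> x; apply: Fhi; near: x; exact: nbhs_pinfty_ge.
have mu_oc (a b : R) : a <= b -> fine (mu `]a, b]%classic) = F b - F a.
  move=> ab; rewrite (_ : `]a, b]%classic = `]-oo, b]%classic `\` `]-oo, a]%classic); last first.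
    apply/seteqP; split => x /=; rewrite !in_itv/=.
      by move=> /andP[ax ->]; split => //; rewrite leNgt ax.
    by move=> [-> /negP]; rewrite -ltNge => ->.
  rewrite measureD//; last by rewrite (le_lt_trans (probability_le1 _ _))// ltry.
  rewrite setIidr; last by move=> x /=; rewrite !in_itv/= => /le_trans; apply.
  by have /= -> := muF a; have /= -> := muF b.
(* [F 1 = 1], and the mass left of [-1] is a countable union of null half-lines. *)
have muJ : mu J = 1%E.
  have mu0 : mu `]-oo, (-1)%R[%classic = 0%E.
    apply/negligibleP => //.
    rewrite (_ : `]-oo, (-1)%R[%classic = \bigcup_n `]-oo, -1 - n.+1%:R^-1]%classic).
      apply: negligible_bigcup => n; apply/negligibleP => //.
      by have := muF (-1 - n.+1%:R^-1); rewrite Flo// ltrBlDr ltrDl invr_gt0 ltr0n.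
    apply/seteqP; split => x /=.
      rewrite in_itv/= => x1; pose m := Num.truncn ((-1 - x)^-1).
      have mx : m.+1%:R^-1 < -1 - x.
        rewrite -[ltRHS]invrK ltf_pV2 ?truncnS_gt// posrE ?ltr0n//.
        by rewrite invr_gt0 subr_gt0.
      by exists m => //=; rewrite in_itv/= lerBrDr addrC -lerBrDr ltW.
    move=> [n _] /=; rewrite !in_itv/= => /le_lt_trans; apply.
    by rewrite ltrBlDr ltrDl invr_gt0.
  apply/eqP; rewrite eq_le probability_le1//=.
  have mN : measurable (`]-oo, (-1)%R[%classic : set R) by [].
  have le1 : (1%E <= mu (J `|` `]-oo, (-1)%R[%classic))%E.
    have <- : mu `]-oo, 1%R]%classic = 1%E by rewrite muF Fhi.
    apply: le_measure; rewrite ?inE//; first exact: measurableU.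
    move=> x /=; rewrite !in_itv/= => x1.
    by have [?|?] := ltP x (-1); [right|left; rewrite x1].
  apply: (le_trans le1); apply: (le_trans (measureU2 mu (measurable_itv _) mN)).
  by have /= -> := mu0; rewrite adde0.
exists mu => // h C l mh hC cvh.
have C0 : 0 <= C.
  have := le_trans (normr_ge0 _) (hC 1 0 _ _).
  by rewrite subr0 normr1 mulr1; apply; lra.
pose M := `|h 1| + C * 3.
have hM y : -1 <= y <= 1 -> `|h y| <= M.
  move=> y1; rewrite -(subrK (h 1) (h y)) addrC (le_trans (ler_normD _ _))// lerD2l.
  apply: (le_trans (hC _ _ _ _)); [lra|lra|].
  by rewrite ler_wpM2l// ler_norml; lra.
have [S Scv] := cvS h M hM.
have inth D : measurable D -> D `<=` J -> mu.-integrable D (EFin \o h).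
  move=> mD DJ; apply: (@integrable_bounded _ _ _ _ _ _ M) => //.
    exact: measurable_funTS.
  by move=> x /DJ /=; rewrite in_itv/=; exact: hM.
pose I x := Rintegral mu (J `&` `]-oo, x]%classic) h.
(* [S] and [I] integrate [h] up to [x] against [dG] and [dF]; the last term corrects
   for the jumps at [x], where [F] and [G] may differ. *)
pose E x := S x - I x - h x * (G x - F x).
(* [G] counts twice: once for [S] and once for the jump correction. *)
pose V x := 2 * G x + F x.
have SI a b : -2 <= a -> a <= b -> b <= 1 ->
    `|S b - S a - h b * (G b - G a)| <= C * (b - a) * (G b - G a).
  move=> a2 ab b1.
  have cvG : Sn (cst 1) n b - Sn (cst 1) n a @[n --> U] --> G b - G a by exact: cvgB.
  have cvl : `|Sn h n b - Sn h n a - h b * (Sn (cst 1) n b - Sn (cst 1) n a)| @[n --> U]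
      --> `|S b - S a - h b * (G b - G a)|.
    by apply: cvg_norm; apply: cvgB; [exact: cvgB | exact: cvgMr].
  have cvr : C * (b - a) * (Sn (cst 1) n b - Sn (cst 1) n a) @[n --> U]
      --> C * (b - a) * (G b - G a) by exact: cvgMr.
  by apply: (ler_cvg_to cvl cvr); apply: filterE => n; exact: Sn_incr.
have II a b : -2 <= a -> a <= b -> b <= 1 ->
    `|I b - I a - h b * (F b - F a)| <= C * (b - a) * (F b - F a).
  move=> a2 ab b1; set D := J `&` `]a, b]%classic.
  have mD : measurable D by exact: measurableI.
  have muD : fine (mu D) = F b - F a.
    by rewrite -mu_oc// /D setIC; congr fine; apply/esym/probability_setIl.
  have -> : I b - I a = Rintegral mu D h.
    rewrite /I (_ : J `&` `]-oo, b]%classic = (J `&` `]-oo, a]%classic) `|` D); last first.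
      rewrite -setIUr; congr (_ `&` _); apply/seteqP; split => x /=; rewrite !in_itv/=.
        by move=> xb; have [xa|xa] := leP x a; [left|right].
      by case=> [/le_trans|/andP[]//]; apply.
    rewrite Rintegral_setU//; [by rewrite addrC addKr|exact: measurableI| |].
      by apply: inth; [apply: measurableU => //; exact: measurableI | move=> x [[]|[]]].
    apply/disj_setPS => x [[_ /=]]; rewrite in_itv/= => xa [_ /=].
    by rewrite in_itv/= ltNge xa.
  have intc c : mu.-integrable D (EFin \o cst c) by exact: finite_measure_integrable_cst.
  have inthD : mu.-integrable D (EFin \o h) by apply: inth => // x [].
  rewrite -muD -Rintegral_cst// -RintegralB//; last exact: intc.
  have inthb : mu.-integrable D (EFin \o (fun x => h x - h b)).
    have := integrableB mD inthD (intc (h b)).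
    by apply: eq_integrable => // x _; rewrite /= EFinB.
  apply: (le_trans (le_normr_Rintegral _ _)) => //.
  rewrite -Rintegral_cst//; apply: le_Rintegral => //.
    by have := integrable_norm inthb.
    exact: intc.
  move=> x [/=]; rewrite !in_itv/= => x1 axb.
  apply: (le_trans (hC _ _ _ _)); [lra|lra|].
  by rewrite ler_wpM2l// ler_norml; lra.
have slow a b : -2 <= a -> a <= b -> b <= 1 ->
    `|E b - E a| <= C * (b - a) * (V b - V a).
  (* The case [a = b] is set apart because [F a <= G b] requires [a < b]. *)
  move=> a2; rewrite le_eqVlt => /predU1P[->|ab] b1; first by rewrite !subrr normr0 mulr0.
  have hS := SI a b a2 (ltW ab) b1.
  have hI := II a b a2 (ltW ab) b1.
  have hGF : `|(h a - h b) * (G a - F a)| <= C * (b - a) * (G b - G a).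
    rewrite normrM; apply: ler_pM => //.
      apply: (le_trans (hC _ _ _ _)); [lra|lra|].
      by rewrite ler_wpM2l// ler_norml; lra.
    by rewrite distrC ger0_norm ?subr_ge0// lerD2r FG.
  have -> : E b - E a = (S b - S a - h b * (G b - G a)) - (I b - I a - h b * (F b - F a))
      + (h a - h b) * (G a - F a) by rewrite /E; ring.
  apply: (le_trans (ler_normD _ _)); apply: (le_trans (lerD (ler_normB _ _) hGF)).
  apply: (le_trans (lerD (lerD hS hI) (lexx _))).
  by rewrite /V le_eqVlt; apply/orP; left; apply/eqP; ring.
have S2 : S (-2) = 0.
  have := Scv (-2); rewrite (_ : (fun n => _) = cst 0); last first.
    by apply/funext => n; apply: Sn_lo; lra.
  by move=> /cvg_unique; apply => //; exact: cvg_cst.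
have S1 : S 1 = l.
  apply: (cvg_unique _ (Scv 1)) => //.
  rewrite (_ : (fun n => _) = (fun n => \sum_(k < K n) w n k * h (z n k))).
    by move=> A Al; apply: sU; exact: cvh.
  by apply/funext => n; exact: Sn_hi.
have I2 : I (-2) = 0.
  rewrite /I (_ : J `&` _ = set0) ?Rintegral_set0//.
  apply/seteqP; split => // x [] /=; rewrite !in_itv/= => /andP[x1 _] x2.
  by have := lt_le_trans N2 (le_trans x1 x2); rewrite ltxx.
have I1 : I 1 = Rintegral mu J h.
  by rewrite /I setIidl// => x /=; rewrite !in_itv/= => /andP[].
(* [F] and [G] agree at both endpoints, so the correction vanishes and [E (-2) = E 1] reads
   [0 = l - I 1]. *)
have := slow_growth_cst slow N21.
rewrite /E S2 S1 I2 I1 (Glo _ N2) (Flo _ N2) (Ghi 1 (lexx 1)) (Fhi 1 (lexx 1)).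
rewrite !subrr !mulr0 !subr0 => /eqP.
by rewrite eq_sym subr_eq0 => /eqP.
Unshelve. all: by end_near. Qed.
End helly.

(** * The Hausdorff moment problem *)

(** After factoring out [x - y], each of the [n] remaining terms is at most [2 ^ n]. *)
Lemma expr_lipschitz (R : realType) (n : nat) (x y : R) :
  -2 <= x <= 1 -> -2 <= y <= 1 ->
  `|x ^+ n - y ^+ n| <= (n%:R * 2 ^+ n) * `|x - y|.
Proof.
move=> x2 y2.
have le2 (t : R) : -2 <= t <= 1 -> `|t| <= 2 by move=> t2; rewrite ler_norml; lra.
rewrite subrXX normrM mulrC ler_wpM2r//.
apply: (le_trans (ler_norm_sum _ _ _)).
have -> : n%:R * 2 ^+ n = \sum_(i < n) (2 ^+ n : R) by rewrite sumr_const card_ord mulr_natl.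
rewrite ler_sum// => i _; rewrite normrM !normrX.
apply: (@le_trans _ _ (2 ^+ (n.-1 - i) * 2 ^+ i)).
  by apply: ler_pM; rewrite ?exprn_ge0// lerXn2r ?nnegrE// le2.
rewrite -exprD ler_eXn2l ?ltr1n// subnK ?leq_pred//.
by case: n i => [[]//|n] i; rewrite -ltnS.
Qed.

(** The Bernstein weights at equally spaced nodes of [[-1, 1]] have moments tending to [f], and
    monomials are Lipschitz test functions for [helly]. *)
Lemma hausdorff_moment (R : realType) (f : nat -> R) :
  f 0%N = 1 -> (forall n, `|f n| <= 1) ->
  (forall (d : nat) (c : nat -> R),
     0 <= \sum_(i < d) \sum_(j < d) c i * c j * f (i + j)%N) ->
  exists2 mu : probability R R, mu `[(-1)%R, 1%R]%classic = 1%E &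
    forall n, f n = Rintegral mu `[(-1)%R, 1%R]%classic (fun s => s ^+ n).
Proof.
move=> f0 f1 hf.
pose z n k : R := 2 * (k%:R / n.+1%:R) - 1.
have [||n k kn|mu muJ muE] := @helly R (fun n => n.+2) (fun n => bernw f n.+1) z.
- by move=> n k; exact: bernw_ge0.
- by move=> n; exact: sum_bernw.
- have : 0 <= (k%:R / n.+1%:R : R) <= 1.
    by rewrite divr_ge0//= ler_pdivrMr// mul1r ler_nat.
  by rewrite /z; move: (_ / _) => t t01; lra.
exists mu => // n; apply/esym/(muE _ (n%:R * 2 ^+ n)).
- exact: measurable_funX.
- by move=> x y; exact: expr_lipschitz.
- exact: cvg_bernw_moment.
Qed.

Theorem theorem1p2 (R : realType) (phi : FG -> R) :
  (forall g h : FG, fgnorm2 R g = fgnorm2 R h -> phi g = phi h) ->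
  phi fg1 = 1 ->
  (posdef (fun g => real_complex R (phi g)) <->
   exists mu : probability R R,
     mu `[(-1)%R, 1%R]%classic = 1%E /\
     forall g : FG,
       ((phi g)%:E = \int[mu]_(s in `[(-1)%R, 1%R]%classic) (s ^+ fgnorm2sq g)%:E)%E)
  /\
  (forall mu1 mu2 : probability R R,
     mu1 `[(-1)%R, 1%R]%classic = 1%E -> mu2 `[(-1)%R, 1%R]%classic = 1%E ->
     (forall g : FG,
        ((phi g)%:E = \int[mu1]_(s in `[(-1)%R, 1%R]%classic) (s ^+ fgnorm2sq g)%:E)%E) ->
     (forall g : FG,
        ((phi g)%:E = \int[mu2]_(s in `[(-1)%R, 1%R]%classic) (s ^+ fgnorm2sq g)%:E)%E) ->
     forall A : set R, measurable A -> mu1 A = mu2 A).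
Proof.
move=> phi_radial phi1.
pose f n := phi (staircase 0 n).
have stair n : fgnorm2sq (staircase 0 n) = n by exact: wnsq_staircase.
have phiE g : phi g = f (fgnorm2sq g).
  by apply: phi_radial; rewrite /fgnorm2 stair.
have phiC x y : phi (fgmul (fginv x) y) = phi (fgmul (fginv y) x).
  by rewrite !phiE !fgnorm2sq_invmul wnsq_mulrevC.
have f0 : f 0%N = 1 by rewrite -phi1 [RHS]phiE.
(* Every natural number is a squared norm, so the integral formula on the group prescribes all
   moments. *)
have momE (mu : probability R R) : (forall g : FG,
      ((phi g)%:E = \int[mu]_(s in `[(-1)%R, 1%R]%classic) (s ^+ fgnorm2sq g)%:E)%E) <->
    forall n, f n = Rintegral mu `[(-1)%R, 1%R]%classic (fun s => s ^+ n).
  split=> [mom n|mom g]; last by rewrite integral_exp_fin -mom phiE.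
  by apply: EFin_inj; rewrite -integral_exp_fin mom stair.
split; last first.
  move=> mu1 mu2 mu1J mu2J /momE mom1 /momE mom2; apply: moment_unique => // n.
  by rewrite -mom1 -mom2.
split=> [/(posdef_psdk phiC) psd|[mu [muJ /momE mom]]].
  have [||mu muJ mom] := hausdorff_moment f0.
  - by move=> n; rewrite -f0; exact: (moment_norm_le phiE psd).
  - exact: (hankel_ge0 phiE psd).
  by exists mu; split => //; apply/momE.
apply/(posdef_psdk phiC)/(@psdk_moment _ mu) => g.
by rewrite phiE mom.
Qed.
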